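(* Let $R$ be a commutative ring, $\mathcal C$ a poset, and $M$ an $S$-presented $R\mathcal C$-module, where $S\subseteq\mathcal C$ is Artinian. Assume that $S_{S,c}M$ is a projective $R$-module for all $c\in B_S(M)$. If $$0\to L\to N\xrightarrow{f}M\to0$$ is an exact sequence of $R\mathcal C$-modules where $f$ is a projective cover, then $B_S(L)=D_S(M)$.
   Context: A poset $\mathcal C$ is regarded as a category with a unique morphism $c\to d$ iff $c\le d$. An $R\mathcal C$-module is a functor $M\colon\mathcal C\to R\text{-}\mathbf{Mod}$; morphisms are natural transformations; exactness is pointwise. $M$ is $S$-presented if the canonical map $\mathrm{colim}_{d\in S,\,d\le c}M(d)\to M(c)$ is an isomorphism for all $c\in\mathcal C$; equivalently, there is an exact sequence $\bigoplus_{s\in S}B_s[\mathrm{Mor}_{\mathcal C}(s,-)]\to\bigoplus_{s\in S}A_s[\mathrm{Mor}_{\mathcal C}(s,-)]\to M\to0$ with $R$-modules $A_s,B_s$, where $A[\mathrm{Mor}_{\mathcal C}(s,-)]=A\otimes_RR[\mathrm{Mor}_{\mathcal C}(s,-)]$ pointwise. For any $R\mathcal C$-module $M$ and $c\in\mathcal C$, let $\lambda_{M,c}\colon\mathrm{colim}_{d<c,\ d\in S}M(d)\to M(c)$ be the natural homomorphism. $B_S(M)=\{c\in\mathcal C\mid\lambda_{M,c}\text{ is not an epimorphism}\}$, $D_S(M)=\{c\in\mathcal C\mid\lambda_{M,c}\text{ is not a monomorphism}\}$, and $S_{S,c}M=M(c)/\mathrm{Im}(\lambda_{M,c})$. A poset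 is Artinian if every non-empty subset has a minimal element. An epimorphism $f\colon N\to M$ is minimal if for all morphisms $g\colon L'\to N$, $fg$ is an epimorphism iff $g$ is an epimorphism. A projective cover of $M$ is a minimal epimorphism $f\colon N\to M$ with $N$ projective in the category of $R\mathcal C$-modules. *)

(* Defs.v *)
From HB Require Import structures.
From mathcomp Require Import all_boot all_order all_algebra.
From mathcomp Require Import finmap all_classical.
Set Implicit Arguments.
Unset Strict Implicit.
Unset Printing Implicit Defensive.
Import Order.TTheory GRing.Theory.
Local Open Scope classical_set_scope.
Local Open Scope ring_scope.
Local Open Scope quotient_scope.

(* Epimorphisms and monomorphisms of modules are the surjective and the
   injective linear maps; [surjective_epiP] and [injective_monoP] below show
   that these are the cancellation properties in the category of modules. *)
Definition surjective (T U : Type) (f : T -> U) := forall y, exists x, f x = y.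

Definition projective_module (R : comPzRingType) (P : lmodType R) :=
  forall (V W : lmodType R) (p : {linear V -> W}) (g : {linear P -> W}),
    surjective p -> exists h : {linear P -> V}, p \o h =1 g.

Section QuotientModule.
Variables (R : comPzRingType) (V : lmodType R) (U : submodClosed V).

(* Over a ring, a subset closed under sums and scaling is closed under
   opposites, which [submodClosed] alone does not record. *)
Definition zmod_of_submod : {pred V} := U.

Let zmod_of_submodP : zmod_closed zmod_of_submod.
Proof.
split=> [|x y xU yU]; first by rewrite -[_ \in _]/(0 \in U) rpred0.
by rewrite -[_ \in _]/(x - y \in U) -scaleN1r rpredD // rpredZ.
Qed.
HB.instance Definition _ := GRing.isZmodClosed.Build V zmod_of_submod
  zmod_of_submodP.

Definition quotmod := Quotient.quot zmod_of_submod.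
HB.instance Definition _ := GRing.Zmodule.on quotmod.

Definition quotmod_pi (x : V) : quotmod := \pi_(Quotient.quot zmod_of_submod) x.

Lemma quotmod_piP x y : quotmod_pi x = quotmod_pi y <-> x - y \in U.
Proof.
rewrite -[_ \in U]/(_ \in zmod_of_submod) Quotient.idealrBE.
by split=> /eqP.
Qed.

Lemma quotmod_pi_surj : surjective quotmod_pi.
Proof. by move=> q; exists (repr q); rewrite /quotmod_pi reprK. Qed.

Let pi_add x y : quotmod_pi (x + y) = quotmod_pi x + quotmod_pi y.
Proof. exact: (raddfD (\pi_(Quotient.quot zmod_of_submod))). Qed.

Definition quotmod_scale (a : R) (q : quotmod) : quotmod :=
  quotmod_pi (a *: repr q).

Let scale_pi a x : quotmod_scale a (quotmod_pi x) = quotmod_pi (a *: x).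
Proof.
apply/quotmod_piP; rewrite -scalerBr rpredZ //; apply/quotmod_piP.
by rewrite /quotmod_pi reprK.
Qed.

Let scaleA a b q : quotmod_scale a (quotmod_scale b q) = quotmod_scale (a * b) q.
Proof. by have [x <-] := quotmod_pi_surj q; rewrite !scale_pi scalerA. Qed.
Let scale1 : left_id 1 quotmod_scale.
Proof. by move=> q; have [x <-] := quotmod_pi_surj q; rewrite scale_pi scale1r. Qed.
Let scaleDr : right_distributive quotmod_scale +%R.
Proof.
move=> a p q; have [x <-] := quotmod_pi_surj p; have [y <-] := quotmod_pi_surj q.
by rewrite -pi_add !scale_pi scalerDr pi_add.
Qed.
Let scaleDl q : {morph quotmod_scale^~ q : a b / a + b}.
Proof.
by move=> a b; have [x <-] := quotmod_pi_surj q; rewrite !scale_pi scalerDl pi_add.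
Qed.
HB.instance Definition _ := GRing.Zmodule_isLmodule.Build R quotmod
  scaleA scale1 scaleDr scaleDl.

Let quotmod_pi_linear : linear quotmod_pi.
Proof. by move=> a x y; rewrite pi_add -scale_pi. Qed.
HB.instance Definition _ := GRing.isLinear.Build R V quotmod *:%R quotmod_pi
  quotmod_pi_linear.

Section Lift.
Variables (W : lmodType R) (f : {linear V -> W}).

Definition quotmod_lift of (forall x, x \in U -> f x = 0) :=
  fun q : quotmod => f (repr q).

Hypothesis fU : forall x, x \in U -> f x = 0.

Lemma quotmod_liftE x : quotmod_lift fU (quotmod_pi x) = f x.
Proof.
apply/eqP; rewrite -subr_eq0 -raddfB; apply/eqP/fU/quotmod_piP.
by rewrite /quotmod_pi reprK.
Qed.

Let quotmod_lift_linear : linear (quotmod_lift fU).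
Proof.
move=> a p q; have [x <-] := quotmod_pi_surj p.
by have [y <-] := quotmod_pi_surj q; rewrite -linearP !quotmod_liftE linearP.
Qed.
HB.instance Definition _ := GRing.isLinear.Build R quotmod W *:%R
  (quotmod_lift fU) quotmod_lift_linear.
End Lift.
End QuotientModule.

Section Span.
Variables (R : comPzRingType) (V : lmodType R) (A : set V).

Definition span_pred : {pred V} := fun v =>
  `[< forall P : {pred V}, submod_closed P -> (forall x, A x -> x \in P) ->
        v \in P >].

Lemma sub_span x : A x -> x \in span_pred.
Proof. by move=> Ax; apply/asboolP => P _; apply. Qed.

Lemma span_min (P : {pred V}) : submod_closed P -> (forall x, A x -> x \in P) ->
  forall v, v \in span_pred -> v \in P.
Proof. by move=> Psub AP v /asboolP; apply. Qed.

Let span_submod : subsemimod_closed span_pred.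
Proof.
apply: GRing.submod_closed_semi; split; first by apply/asboolP => P [].
move=> a u v /asboolP Hu /asboolP Hv; apply/asboolP => P Pc AP.
by apply: Pc.2; [apply: Hu|apply: Hv].
Qed.
HB.instance Definition _ := GRing.isSubmodClosed.Build R V span_pred span_submod.
End Span.

Section Image.
Variables (R : comPzRingType) (V W : lmodType R) (f : {linear V -> W}).

Definition image_pred : {pred W} := fun y => `[< range f y >].

Let image_submod : subsemimod_closed image_pred.
Proof.
apply: GRing.submod_closed_semi; split; first by apply/asboolP; exists 0; rewrite ?raddf0.
move=> a u v /asboolP[x _ <-] /asboolP[y _ <-].
by apply/asboolP; exists (a *: x + y); rewrite /= ?linearP.
Qed.
HB.instance Definition _ := GRing.isSubmodClosed.Build R W image_pred image_submod.

Definition cokernel : lmodType R := quotmod image_pred.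
End Image.

Lemma surjective_epiP (R : comPzRingType) (V W : lmodType R)
    (f : {linear V -> W}) :
  surjective f <->
  (forall (X : lmodType R) (g h : {linear W -> X}), g \o f =1 h \o f -> g =1 h).
Proof.
split=> [fs X g h gh y|epi y]; first by have [x <-] := fs y; exact: gh.
pose p : {linear W -> cokernel f} := quotmod_pi (image_pred f).
have pf : p \o f =1 (\0 : {linear W -> cokernel f}) \o f.
  move=> x; rewrite -[RHS]/0 -(raddf0 p); apply/quotmod_piP.
  by rewrite subr0; apply/asboolP; exists x.
have := epi _ _ _ pf y; rewrite -[RHS]/0 -(raddf0 p) => /quotmod_piP.
by rewrite subr0 => /asboolP[x _ <-]; exists x.
Qed.

Lemma injective_monoP (R : comPzRingType) (V W : lmodType R)
    (f : {linear V -> W}) :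
  injective f <->
  (forall (X : lmodType R) (g h : {linear X -> V}), f \o g =1 f \o h -> g =1 h).
Proof.
split=> [fi X g h gh x|mono x y fxy]; first exact/fi/gh.
pose mul (z : V) (r : R^o) : V := r *: z.
have mul_linear z : linear (mul z).
  by move=> a r t; rewrite /mul scalerDl scalerA.
pose ml z : {linear R^o -> V} := HB.pack (mul z)
  (GRing.isLinear.Build R R^o V *:%R (mul z) (mul_linear z)).
have : ml x =1 ml y by apply: mono => r; rewrite /= /mul !linearZ /= fxy.
by move=> /(_ 1); rewrite /= /mul !scale1r.
Qed.

Section DirectProduct.
Variables (R : comPzRingType) (I : choiceType) (V : I -> lmodType R).

Definition dprod := forall i, V i.
HB.instance Definition _ := Choice.on dprod.

Let zero : dprod := fun i => 0 : V i.
Let add (f g : dprod) : dprod := fun i => f i + g i.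
Let opp (f : dprod) : dprod := fun i => - f i.
Let scale (a : R) (f : dprod) : dprod := fun i => a *: f i.

Let addA : associative add.
Proof. by move=> f g h; apply: functional_extensionality_dep => i; exact: addrA. Qed.
Let addC : commutative add.
Proof. by move=> f g; apply: functional_extensionality_dep => i; exact: addrC. Qed.
Let add0 : left_id zero add.
Proof. by move=> f; apply: functional_extensionality_dep => i; exact: add0r. Qed.
Let addN : left_inverse zero opp add.
Proof. by move=> f; apply: functional_extensionality_dep => i; exact: addNr. Qed.
HB.instance Definition _ := GRing.isZmodule.Build dprod addA addC add0 addN.

Let scaleA a b f : scale a (scale b f) = scale (a * b) f.
Proof. by apply: functional_extensionality_dep => i; exact: scalerA. Qed.
Let scale1 : left_id 1 scale.
Proof. by move=> f; apply: functional_extensionality_dep => i; exact: scale1r. Qed.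
Let scaleDr : right_distributive scale +%R.
Proof. by move=> a f g; apply: functional_extensionality_dep => i; exact: scalerDr. Qed.
Let scaleDl f : {morph scale^~ f : a b / a + b}.
Proof. by move=> a b; apply: functional_extensionality_dep => i; exact: scalerDl. Qed.
HB.instance Definition _ := GRing.Zmodule_isLmodule.Build R dprod
  scaleA scale1 scaleDr scaleDl.

Definition dsum_pred : {pred dprod} :=
  fun f => `[< finite_set [set i | f i != 0] >].

Let dsum_submod : subsemimod_closed dsum_pred.
Proof.
apply: GRing.submod_closed_semi; split.
  by apply/asboolP; apply: sub_finite_set (finite_set0 I) => i /=; rewrite eqxx.
move=> a f g /asboolP finf /asboolP fing; apply/asboolP.
apply: (@sub_finite_set _ _ ([set i | f i != 0] `|` [set i | g i != 0])).
  move=> i /= fgi; have [fi0|] := eqVneq (f i) 0; last by left.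
  right; apply: contraNneq fgi => gi0.
  by apply/eqP; rewrite -[LHS]/(a *: f i + g i) fi0 gi0 scaler0 addr0.
by rewrite finite_setU.
Qed.
HB.instance Definition _ := GRing.isSubmodClosed.Build R dprod dsum_pred dsum_submod.

Record dsum := DSum { dsum_val : dprod; _ : dsum_val \in dsum_pred }.
HB.instance Definition _ := [isSub of dsum for dsum_val].
HB.instance Definition _ := [Choice of dsum by <:].
HB.instance Definition _ := [SubChoice_isSubLmodule of dsum by <:].

Definition dsum_fun (f : dsum) : forall i, V i := dsum_val f.
Coercion dsum_fun : dsum >-> Funclass.

Lemma dsum_finite (f : dsum) : finite_set [set i | f i != 0].
Proof. exact/asboolP/(valP f). Qed.

Lemma dsum_ext (f g : dsum) : (forall i, f i = g i) -> f = g.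
Proof. by move=> fg; apply/val_inj/functional_extensionality_dep. Qed.

Definition dsum_in_fun i (x : V i) : dprod :=
  @eqtype.dfwith I V (fun j => 0) i x.

Lemma dsum_in_subproof i (x : V i) : dsum_in_fun x \in dsum_pred.
Proof.
apply/asboolP; apply: sub_finite_set (finite_set1 i) => j /=.
by rewrite /dsum_in_fun; case: eqtype.dfwithP => //= k _; rewrite eqxx.
Qed.

Definition dsum_in i (x : V i) : dsum := DSum (dsum_in_subproof x).

Let dsum_in_linear i : linear (@dsum_in i).
Proof.
move=> a x y; apply: dsum_ext => j; rewrite /=.
rewrite -[RHS]/(a *: dsum_in_fun x j + dsum_in_fun y j) /dsum_in_fun.
have [<-|ij] := eqVneq i j; first by rewrite !eqtype.dfwith_in.
by rewrite !eqtype.dfwith_out // scaler0 addr0.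
Qed.
HB.instance Definition _ i := GRing.isLinear.Build R (V i) dsum *:%R
  (@dsum_in i) (@dsum_in_linear i).

Section Desc.
Variables (X : lmodType R) (g : forall i, {linear V i -> X}).

(* The map induced by the [g i], summing over the finite support of [f]. *)
Definition dsum_desc (f : dsum) : X := \sum_(i \in [set: I]) g i (f i).

Lemma dsum_descE (D : set I) (f : dsum) : finite_set D ->
  [set i | f i != 0] `<=` D -> dsum_desc f = \sum_(i \in D) g i (f i).
Proof.
move=> finD fD; apply/esym/fsbig_widen => // i [_ /= Di].
by have [->|/fD//] := eqVneq (f i) 0; rewrite raddf0.
Qed.

Lemma dsum_desc_in i (x : V i) : dsum_desc (dsum_in x) = g i x.
Proof.
rewrite (@dsum_descE [set i]) //; first by rewrite fsbig_set1 /dsum_fun /= /dsum_in_fun eqtype.dfwith_in.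
move=> j /=; rewrite /dsum_in_fun.
by case: eqtype.dfwithP => //= k _; rewrite eqxx.
Qed.

Let dsum_desc_linear : linear dsum_desc.
Proof.
move=> a f h.
pose D := [set i | f i != 0] `|` [set i | h i != 0].
have finD : finite_set D by rewrite finite_setU; split; exact: dsum_finite.
have fhD : [set i | (a *: f + h) i != 0] `<=` D.
  move=> i /= fhi; have [fi0|] := eqVneq (f i) 0; last by left.
  right; apply: contraNneq fhi => hi0.
  by apply/eqP; rewrite -[LHS]/(a *: f i + h i) fi0 hi0 scaler0 addr0.
rewrite (dsum_descE finD fhD) (@dsum_descE D f) //; last by move=> i; left.
rewrite (@dsum_descE D h) //; last by move=> i; right.
rewrite !fsbig_finite //= scaler_sumr -big_split /=; apply: eq_bigr => i _.
by rewrite -linearP.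
Qed.
HB.instance Definition _ := GRing.isLinear.Build R dsum X *:%R
  dsum_desc dsum_desc_linear.
End Desc.

Lemma dsum_sumE (f : dsum) :
  f = \sum_(i \in [set i | f i != 0]) dsum_in (f i).
Proof.
apply: dsum_ext => j; have fin := dsum_finite f.
rewrite fsbig_finite //= .
have -> (r : seq I) : (\sum_(i <- r) dsum_in (f i) : dsum) j =
    \sum_(i <- r) dsum_in_fun (f i) j.
  elim: r => [|i r IH]; first by rewrite !big_nil.
  by rewrite !big_cons -IH.
have [fj0|fj0] := eqVneq (f j) 0.
  rewrite big1_seq ?fj0 // => i /andP[_]; rewrite /dsum_in_fun.
  have [->|ij] := eqVneq i j; first by rewrite fj0 eqtype.dfwith_in.
  by rewrite eqtype.dfwith_out.
rewrite (bigD1_seq j) ?fset_uniq //=; last by rewrite in_fset_set // inE.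
rewrite /dsum_in_fun eqtype.dfwith_in big1 ?addr0 // => i ij.
by rewrite eqtype.dfwith_out.
Qed.
End DirectProduct.

Section PosetModules.
Variables (R : comPzRingType) (disp : Order.disp_t) (C : porderType disp).

Record pmod := PMod {
  pmod_obj :> C -> lmodType R;
  pmod_map : forall c d : C, (c <= d)%O -> {linear pmod_obj c -> pmod_obj d};
  pmod_map_id : forall (c : C) (h : (c <= c)%O) x, pmod_map h x = x;
  pmod_map_comp : forall (c d e : C) (h : (c <= d)%O) (k : (d <= e)%O)
    (l : (c <= e)%O) x, pmod_map k (pmod_map h x) = pmod_map l x
}.

Record phom (M N : pmod) := PHom {
  phom_fun :> forall c, {linear M c -> N c};
  phom_nat : forall (c d : C) (h : (c <= d)%O) x,
    phom_fun d (pmod_map M h x) = pmod_map N h (phom_fun c x)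
}.

Section Comp.
Variables (L M N : pmod) (f : phom M N) (g : phom L M).

Let comp_fun c : {linear L c -> N c} := f c \o g c.
Let comp_nat (c d : C) (h : (c <= d)%O) x :
  comp_fun d (pmod_map L h x) = pmod_map N h (comp_fun c x).
Proof. by rewrite /= !phom_nat. Qed.
Definition phom_comp : phom L N := PHom comp_nat.
End Comp.

(* Exactness, hence also being an epimorphism or a monomorphism, is pointwise;
   see [pepi_cancelP] for epimorphisms. *)
Definition pepi (M N : pmod) (f : phom M N) := forall c, surjective (f c).
Definition pmono (M N : pmod) (f : phom M N) := forall c, injective (f c).

Definition short_exact (L N M : pmod) (i : phom L N) (f : phom N M) :=
  [/\ pmono i, forall c, range (i c) = [set x | f c x = 0] & pepi f].

Definition projective_pmod (P : pmod) :=
  forall (M N : pmod) (p : phom M N) (g : phom P N), pepi p ->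
    exists h : phom P M, forall c, p c \o h c =1 g c.

Definition minimal_epi (N M : pmod) (f : phom N M) :=
  pepi f /\ forall (L : pmod) (g : phom L N), pepi (phom_comp f g) <-> pepi g.

Definition projective_cover (N M : pmod) (f : phom N M) :=
  minimal_epi f /\ projective_pmod N.

Section Colimit.
Variables (M : pmod) (J : set C).

Definition colim_diag (d : J) : lmodType R := M (val d).

Definition colim_rel : set (dsum colim_diag) :=
  [set r | exists (d e : J) (h : (val d <= val e)%O) (x : M (val d)),
    r = dsum_in (V := colim_diag) (pmod_map M h x : colim_diag e)
        - dsum_in (x : colim_diag d)].

(* The colimit of the restriction of [M] to the full subposet [J]: the direct
   sum modulo the transition maps. [colim_desc_in] and [colim_desc_unique]
   give its universal property. *)
Definition colim : lmodType R := quotmod (span_pred colim_rel).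

Definition colim_in (d : J) : {linear colim_diag d -> colim} :=
  quotmod_pi (span_pred colim_rel) \o @dsum_in _ _ colim_diag d.

Lemma colim_in_compat (d e : J) (h : (val d <= val e)%O) x :
  colim_in e (pmod_map M h x) = colim_in d x.
Proof. by apply/quotmod_piP/sub_span; exists d, e, h, x. Qed.

Section Desc.
Variables (X : lmodType R) (g : forall d : J, {linear M (val d) -> X}).
Hypothesis g_compat : forall (d e : J) (h : (val d <= val e)%O) x,
  g e (pmod_map M h x) = g d x.

Lemma colim_desc_subproof r :
  r \in span_pred colim_rel -> dsum_desc (V := colim_diag) g r = 0.
Proof.
pose F : {linear dsum colim_diag -> X} := dsum_desc (V := colim_diag) g.
pose P : {pred dsum colim_diag} := fun r => F r == 0.
move=> rS; rewrite -[LHS]/(F r); apply/eqP.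
apply: (@span_min _ _ colim_rel P) => //; first split.
- by rewrite unfold_in /P raddf0.
- move=> a u v; rewrite !unfold_in /P => /eqP u0 /eqP v0.
  by rewrite linearP u0 v0 scaler0 addr0.
move=> _ [d [e [h [x ->]]]]; rewrite unfold_in /P raddfB /= !dsum_desc_in.
by rewrite g_compat subrr.
Qed.

Definition colim_desc : {linear colim -> X} := quotmod_lift colim_desc_subproof.

Lemma colim_desc_in (d : J) x : colim_desc (colim_in d x) = g d x.
Proof. exact: etrans (quotmod_liftE _ _) (dsum_desc_in _ _). Qed.

Lemma colim_desc_unique (k : {linear colim -> X}) :
  (forall (d : J) x, k (colim_in d x) = g d x) -> k =1 colim_desc.
Proof.
move=> kg q; have [f <-] := quotmod_pi_surj q.
rewrite (dsum_sumE f) fsbig_finite; last exact: dsum_finite.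
rewrite !raddf_sum; apply: eq_bigr => d _.
exact: etrans (kg d (f d)) (esym (@colim_desc_in d (f d))).
Qed.
End Desc.

Section Canonical.
Variable (c : C).
Hypothesis Jc : forall d, J d -> (d <= c)%O.

Let canon_fun (d : J) : {linear M (val d) -> M c} :=
  pmod_map M (Jc (set_mem (valP d))).
Let canon_compat (d e : J) (h : (val d <= val e)%O) x :
  canon_fun e (pmod_map M h x) = canon_fun d x.
Proof. exact: pmod_map_comp. Qed.

(* The canonical map from colim_J M to M(c), for [c] an upper bound of [J]. *)
Definition colim_canon : {linear colim -> M c} := colim_desc canon_compat.
End Canonical.
End Colimit.

Section Presentation.
Variables (S : set C) (M : pmod).

Definition below (c : C) : set C := [set d | S d /\ (d <= c)%O].
Definition sbelow (c : C) : set C := [set d | S d /\ (d < c)%O].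

Lemma below_ub c d : below c d -> (d <= c)%O. Proof. by case. Qed.
Lemma sbelow_ub c d : sbelow c d -> (d <= c)%O. Proof. by case=> _ /ltW. Qed.

Definition presented :=
  forall c, bijective (colim_canon M (@below_ub c)).

Definition lambda (c : C) : {linear colim M (sbelow c) -> M c} :=
  colim_canon M (@sbelow_ub c).

(* B_S(M) *)
Definition births : set C := [set c | ~ surjective (lambda c)].
(* D_S(M) *)
Definition deaths : set C := [set c | ~ injective (lambda c)].

(* S_{S,c} M *)
Definition top_module (c : C) : lmodType R := cokernel (lambda c).
End Presentation.

Section PEpi.
Variables (M N : pmod) (f : phom M N).

Let coker_obj c : lmodType R := cokernel (f c).
Let coker_sub (c d : C) (h : (c <= d)%O) y : y \in image_pred (f c) ->
  (quotmod_pi (image_pred (f d)) \o pmod_map N h) y = 0.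
Proof.
move=> /asboolP[x _ <-].
pose p : {linear N d -> coker_obj d} := quotmod_pi (image_pred (f d)).
rewrite -(raddf0 p) /=; apply/quotmod_piP.
by rewrite subr0 -phom_nat; apply/asboolP; exists (pmod_map M h x).
Qed.
Let coker_map (c d : C) (h : (c <= d)%O) : {linear coker_obj c -> coker_obj d} :=
  quotmod_lift (coker_sub h).
Let coker_pi c : {linear N c -> coker_obj c} := quotmod_pi (image_pred (f c)).
Let coker_map_pi (c d : C) (h : (c <= d)%O) y :
  coker_map h (coker_pi c y) = coker_pi d (pmod_map N h y).
Proof. exact: quotmod_liftE. Qed.
Let coker_id (c : C) (h : (c <= c)%O) q : coker_map h q = q.
Proof.
by have [x <-] := quotmod_pi_surj q; rewrite [LHS]coker_map_pi pmod_map_id.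
Qed.
Let coker_comp (c d e : C) (h : (c <= d)%O) (k : (d <= e)%O) (l : (c <= e)%O) q :
  coker_map k (coker_map h q) = coker_map l q.
Proof.
have [x <-] := quotmod_pi_surj q.
rewrite [RHS]coker_map_pi -(pmod_map_comp h k l) -!coker_map_pi.
by [].
Qed.
Let coker : pmod := PMod coker_id coker_comp.
Let coker_hom : phom N coker :=
  @PHom N coker coker_pi (fun c d h x => esym (coker_map_pi h x)).
Let zero_fun c : {linear N c -> coker c} := \0.
Let zero_nat (c d : C) (h : (c <= d)%O) x :
  zero_fun d (pmod_map N h x) = pmod_map coker h (zero_fun c x).
Proof. exact: esym (raddf0 (coker_map h)). Qed.
Let zero_hom : phom N coker := PHom zero_nat.

Lemma pepi_cancelP : pepi f <->
  (forall (X : pmod) (g h : phom N X),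
     (forall c, g c \o f c =1 h c \o f c) -> forall c, g c =1 h c).
Proof.
split=> [fs X g h gh c|epi c y].
  by apply/(surjective_epiP (f c)).1 => //; exact: fs.
have pf c' : coker_hom c' \o f c' =1 zero_hom c' \o f c'.
  move=> x; rewrite -[RHS]/0 -(raddf0 (coker_pi c')); apply/quotmod_piP.
  by rewrite subr0; apply/asboolP; exists x.
have := epi coker coker_hom zero_hom pf c y.
rewrite -[RHS]/0 -(raddf0 (coker_pi c)) => /quotmod_piP.
by rewrite subr0 => /asboolP[x _ <-]; exists x.
Qed.
End PEpi.
End PosetModules.

(* The poset [S], with the order induced from [C], is Artinian. *)
Definition artinian (disp : Order.disp_t) (C : porderType disp) (S : set C) :=
  forall A : set C, A `<=` S -> A !=set0 ->
    exists2 m, A m & forall x, A x -> ~ (x < m)%O.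

(* Main.v *)
(* Let P(c) be the direct sum of the N(s) for s <= c in S, with its evident
   counit P -> N. As M is generated in degrees S, the composite P -> N -> M is
   an epimorphism, so P -> N is one by minimality, and it splits because N is
   projective. For P the maps lambda are inclusions of summands, hence lambda_N
   is injective, being a retract. Minimality also makes N and M have the same
   tops: a section of top_c N -> top_c M (which exists as top_c M is projective)
   cuts out a submodule of N that still surjects onto M, and this submodule is
   proper unless top_c N -> top_c M is injective. Finally the snake lemma for
   lambda, from colim L -> colim N -> colim M -> 0 to
   0 -> L(c) -> N(c) -> M(c) -> 0, identifies coker lambda_L with ker lambda_M. *)
Require Import Defs.
From HB Require Import structures.
From mathcomp Require Import all_boot all_order all_algebra.
From mathcomp Require Import all_classical.
Set Implicit Arguments.
Unset Strict Implicit.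
Unset Printing Implicit Defensive.
Import Order.TTheory GRing.Theory.
Local Open Scope classical_set_scope.
Local Open Scope ring_scope.

(** The value at w is that of [g] at a chosen preimage. Two preimages differ by an element of the
    kernel of [p], which [g] kills, so the choice is immaterial and linearity follows. *)
Lemma linear_factor (R : comPzRingType) (V W X : lmodType R)
    (p : {linear V -> W}) (g : {linear V -> X}) :
  surjective p -> (forall x, p x = 0 -> g x = 0) ->
  exists h : {linear W -> X}, h \o p =1 g.
Proof.
move=> ps pg; pose h w : X := g (projT1 (cid (ps w))).
have hE x : h (p x) = g x.
  rewrite /h; case: (cid _) => y /= pyx; apply/eqP.
  by rewrite -subr_eq0 -linearB pg // linearB /= pyx subrr.
have h_linear : linear h.
  move=> a u v; have [x <-] := ps u; have [y <-] := ps v.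
  by rewrite -linearP !hE linearP.
pose hl : {linear W -> X} := HB.pack h (GRing.isLinear.Build R W X *:%R h h_linear).
by exists hl.
Qed.

Lemma dsum_ind (R : comPzRingType) (I : choiceType) (V : I -> lmodType R)
    (P : dsum V -> Prop) :
  P 0 -> (forall u v, P u -> P v -> P (u + v)) ->
  (forall i (x : V i), P (dsum_in x)) -> forall u, P u.
Proof.
move=> P0 PD Pin u; rewrite (dsum_sumE u) fsbig_finite; last exact: dsum_finite.
exact: big_ind.
Qed.

(** * Functoriality and right exactness of colimits over a subposet *)

Section Colim.
Variables (R : comPzRingType) (disp : Order.disp_t) (C : porderType disp).
Implicit Types (M N L : pmod R C) (J : set C).

Lemma colim_ind M J (P : colim M J -> Prop) :
  P 0 -> (forall u v, P u -> P v -> P (u + v)) ->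
  (forall (d : J) x, P (colim_in M d x)) -> forall u, P u.
Proof.
move=> P0 PD Pin u; have [r <-] := quotmod_pi_surj u.
elim/dsum_ind: r => [|r s Pr Ps|d x]; last exact: Pin.
- by rewrite linear0.
- by rewrite linearD; exact: PD.
Qed.

Lemma colim_eq M J (X : lmodType R) (g h : {linear colim M J -> X}) :
  (forall (d : J) x, g (colim_in M d x) = h (colim_in M d x)) -> g =1 h.
Proof.
move=> gh; elim/colim_ind => [|u v gu gv|//]; first by rewrite !linear0.
by rewrite !linearD gu gv.
Qed.

Section Map.
Variables (M N : pmod R C) (J : set C) (f : phom M N).

Let map_fun (d : J) : {linear M (val d) -> colim N J} :=
  colim_in N d \o f (val d).
Let map_compat (d e : J) (h : (val d <= val e)%O) x :
  map_fun e (pmod_map M h x) = map_fun d x.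
Proof. by rewrite /= (phom_nat f h x) [LHS]colim_in_compat. Qed.

Definition colim_map : {linear colim M J -> colim N J} :=
  colim_desc map_compat.

Lemma colim_map_in (d : J) x :
  colim_map (colim_in M d x) = colim_in N d (f (val d) x).
Proof. exact: colim_desc_in. Qed.

Lemma colim_map_surj : pepi f -> surjective colim_map.
Proof.
move=> fs; elim/colim_ind => [|u v [u' <-] [v' <-]|d x].
- by exists 0; rewrite linear0.
- by exists (u' + v'); rewrite linearD.
- by have [y <-] := fs _ x; exists (colim_in M d y); rewrite colim_map_in.
Qed.

End Map.

Lemma colim_canon_in M J c (Jc : forall d, J d -> (d <= c)%O) (d : J)
    (h : (val d <= c)%O) x :
  colim_canon M Jc (colim_in M d x) = pmod_map M h x.
Proof.
rewrite /colim_canon colim_desc_in.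
by rewrite (Prop_irrelevance (Jc _ _) h).
Qed.

Lemma lambda_nat (S : set C) M N (f : phom M N) c u :
  lambda S N c (colim_map (sbelow S c) f u) = f c (lambda S M c u).
Proof.
elim/colim_ind: u => [|u v IHu IHv|d x]; first by rewrite !linear0.
  by rewrite !linearD IHu IHv.
have h := sbelow_ub (set_mem (valP d)).
by rewrite colim_map_in !(colim_canon_in _ h) phom_nat.
Qed.

(** The projection [p] onto the cokernel of [colim_map J i] factors through [colim_map J f], hence
    kills [u]; so [u] lies in the image. *)
Lemma colim_right_exact L N M (i : phom L N) (f : phom N M) J u :
  short_exact i f -> colim_map J f u = 0 -> exists v, colim_map J i v = u.
Proof.
case=> _ ex fs fu0.
pose p : {linear colim N J -> cokernel (colim_map J i)} :=
  quotmod_pi (image_pred (colim_map J i)).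
have pin v : p (colim_map J i v) = 0.
  rewrite -(linear0 p); apply/quotmod_piP.
  by rewrite subr0; apply/asboolP; exists v.
(* On N(d), [p] after [colim_in] kills the image of [i], which is the kernel of [f], so it descends
   to M(d). *)
have gex (d : J) : exists g : {linear M (val d) -> cokernel (colim_map J i)},
    g \o f (val d) =1 p \o colim_in N d.
  apply: linear_factor => [|x fx0]; first exact: fs.
  have : range (i (val d)) x by rewrite ex.
  by case=> y _ <-; rewrite -(pin (colim_in L d y)) colim_map_in.
pose g d := projT1 (cid (gex d)); have gE d := projT2 (cid (gex d)).
have g_compat (d e : J) (h : (val d <= val e)%O) x :
    g e (pmod_map M h x) = g d x.
  have [y <-] := fs _ x; rewrite -phom_nat.
  by rewrite [LHS]gE [RHS]gE; congr (p _); exact: colim_in_compat.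
have desc_f : colim_desc g_compat \o colim_map J f =1 p.
  apply: colim_eq => d x.
  rewrite -[LHS]/(colim_desc g_compat (colim_map J f (colim_in N d x))).
  rewrite colim_map_in colim_desc_in; exact: gE.
have : p u = p 0.
  rewrite linear0 -desc_f -[LHS]/(colim_desc g_compat (colim_map J f u)).
  by rewrite fu0 linear0.
by move=> /quotmod_piP; rewrite subr0 => /asboolP[v _ <-]; exists v.
Qed.

End Colim.

(** * The module induced from the values of N on S, and its counit *)

Section Induced.
Variables (R : comPzRingType) (disp : Order.disp_t) (C : porderType disp).
Variables (S : set C) (N : pmod R C).

Lemma below_trans (c d : C) (h : (c <= d)%O) (s : below S c) :
  val s \in below S d.
Proof.
have /set_mem[Ss sc] := valP s.
by apply/mem_set; split=> //; exact: le_trans h.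
Qed.

Definition widen_below (c d : C) (h : (c <= d)%O) (s : below S c) : below S d :=
  SigSub (below_trans h s).

Let obj (c : C) : lmodType R := dsum (colim_diag N (J := below S c)).

Let map_in (c d : C) (h : (c <= d)%O) (s : below S c) :
    {linear colim_diag N s -> obj d} :=
  (@dsum_in _ _ (colim_diag N (J := below S d)) (widen_below h s)
    : {linear colim_diag N (widen_below h s) -> dsum _}).

Let map (c d : C) (h : (c <= d)%O) : {linear obj c -> obj d} :=
  dsum_desc (map_in h).

Let mapE (c d : C) (h : (c <= d)%O) s x :
  map h (@dsum_in _ _ (colim_diag N (J := below S c)) s x) = map_in h s x.
Proof. exact: dsum_desc_in. Qed.

Let map_id (c : C) (h : (c <= c)%O) x : map h x = x.
Proof.
elim/dsum_ind: x => [|u v IHu IHv|s x]; first by rewrite linear0.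
  by rewrite linearD IHu IHv.
rewrite mapE /map_in; case: s x => s hs x.
rewrite /widen_below; move: (below_trans _ _) => /= hs'.
by rewrite (bool_irrelevance hs' hs).
Qed.

Let map_comp (c d e : C) (h : (c <= d)%O) (k : (d <= e)%O) (l : (c <= e)%O) x :
  map k (map h x) = map l x.
Proof.
elim/dsum_ind: x => [|u v IHu IHv|s x]; first by rewrite !linear0.
  by rewrite !linearD IHu IHv.
rewrite !mapE.
rewrite /map_in /widen_below; move: (below_trans l s) (below_trans k _) => /= p q.
by rewrite (bool_irrelevance p q).
Qed.

(** The direct sum over s in S of N(s)[Mor(s,-)]. *)
Definition induced : pmod R C := PMod map_id map_comp.

Definition induced_in (c : C) (s : below S c) : {linear N (val s) -> induced c} :=
  (@dsum_in _ _ (colim_diag N (J := below S c)) s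
    : {linear colim_diag N s -> dsum _}).

Lemma induced_ind c (P : induced c -> Prop) :
  P 0 -> (forall u v, P u -> P v -> P (u + v)) ->
  (forall s x, P (induced_in s x)) -> forall u, P u.
Proof. exact: dsum_ind. Qed.

Lemma induced_map_in (c d : C) (h : (c <= d)%O) s x :
  pmod_map induced h (induced_in s x) = induced_in (widen_below h s) x.
Proof. exact: mapE. Qed.

Let counit_in (c : C) (s : below S c) : {linear colim_diag N s -> N c} :=
  pmod_map N (below_ub (set_mem (valP s))).

Let counit_fun (c : C) : {linear induced c -> N c} :=
  dsum_desc (@counit_in c).

Let counit_inE (c : C) (s : below S c) (h : (val s <= c)%O) x :
  counit_fun c (induced_in s x) = pmod_map N h x.
Proof.
rewrite [LHS]dsum_desc_in /counit_in.
by rewrite (Prop_irrelevance (below_ub _) h).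
Qed.

Let counit_nat (c d : C) (h : (c <= d)%O) x :
  counit_fun d (pmod_map induced h x) = pmod_map N h (counit_fun c x).
Proof.
elim/induced_ind: x => [|u v IHu IHv|s x]; first by rewrite !linear0.
  by rewrite !linearD IHu IHv.
have sc := below_ub (set_mem (valP s)).
rewrite induced_map_in (counit_inE sc) (pmod_map_comp _ _ (le_trans sc h)).
exact: (counit_inE (s := widen_below h s)).
Qed.

Definition counit : phom induced N := PHom counit_nat.

Lemma counit_in_map (c : C) (s : below S c) (h : (val s <= c)%O) x :
  counit c (induced_in s x) = pmod_map N h x.
Proof. exact: counit_inE. Qed.

(** M(c) is generated by the images of M(s) for s <= c in S, and each element of M(s) lifts through
    [f] to the summand N(s). *)
Lemma pepi_counit_comp M (f : phom N M) :
  presented S M -> pepi f -> pepi (phom_comp f counit).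
Proof.
move=> pM fs c m; have [r _ rK] := pM c; rewrite -(rK m).
elim/colim_ind: (r m) => [|u v [u' Hu] [v' Hv]|s x].
- by exists 0; rewrite !linear0.
- by exists (u' + v'); rewrite !linearD Hu Hv.
- have [y <-] := fs _ x; exists (induced_in s y).
  have sc := below_ub (set_mem (valP s)).
  rewrite /= (counit_in_map sc) phom_nat.
  exact/esym/colim_canon_in.
Qed.

(* [retr c] sends the summands N(s) with s < c to the colimit and kills the
   others; composed with a section of [counit] it retracts [lambda S N c]. *)
Let retr_in (c : C) (s : below S c) :
    {linear colim_diag N s -> colim N (sbelow S c)} :=
  match pselect (sbelow S c (val s)) with
  | left h => colim_in N (SigSub (mem_set h) : sbelow S c)
  | right _ => \0
  end.

Let retr (c : C) : {linear induced c -> colim N (sbelow S c)} :=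
  dsum_desc (@retr_in c).

(** A summand at s <= d < c is never killed by [retr]; its class at s equals the class of its counit
    image at d by compatibility in the colimit. *)
Let retr_map (c : C) (d : sbelow S c) (h : (val d <= c)%O) y :
  retr c (pmod_map induced h y) = colim_in N d (counit (val d) y).
Proof.
elim/induced_ind: y => [|u v IHu IHv|s x]; first by rewrite !linear0.
  by rewrite !linearD IHu IHv.
have sd := below_ub (set_mem (valP s)).
rewrite induced_map_in (counit_in_map sd) [LHS]dsum_desc_in /retr_in.
case: pselect => [sc|[]].
  by apply/esym; exact: (colim_in_compat (d := SigSub (mem_set sc) : sbelow S c)).
split; first by case: (set_mem (valP s)).
by apply: le_lt_trans sd _; case: (set_mem (valP d)).
Qed.

Lemma lambda_inj : projective_pmod N -> pepi counit ->
  forall c, injective (lambda S N c).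
Proof.
move=> Nproj eps c.
pose id_N := @PHom _ _ _ N N (fun=> idfun) (fun _ _ _ _ => erefl).
have [s sK] := Nproj _ _ counit id_N eps.
apply: (can_inj (g := retr c \o s c)).
apply: (colim_eq (g := (retr c \o s c) \o lambda S N c) (h := idfun)) => d x.
have h := sbelow_ub (set_mem (valP d)).
rewrite -[LHS]/(retr c (s c (lambda S N c (colim_in N d x)))).
(* Naturality turns [s] of a transported element into the transport of [s (val d) x], to which
   [retr_map] applies. *)
rewrite (colim_canon_in _ h) phom_nat retr_map; congr (colim_in _ _ _); exact: sK.
Qed.

(** Here d may lie outside S: the counit writes an element of N(d) through values at s <= d in S,
    and each such s is strictly below c. *)
Lemma pmod_map_lambda (c d : C) (h : (d <= c)%O) : (d < c)%O -> pepi counit ->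
  forall x, exists u, lambda S N c u = pmod_map N h x.
Proof.
move=> dc eps x; have [y <-] := eps d x.
elim/induced_ind: y => [|u v [u' Hu] [v' Hv]|s z].
- by exists 0; rewrite !linear0.
- by exists (u' + v'); rewrite !linearD Hu Hv.
have [Ss sd] := set_mem (valP s).
have sc : sbelow S c (val s) by split=> //; exact: le_lt_trans sd dc.
exists (colim_in N (SigSub (mem_set sc) : sbelow S c) z).
rewrite (counit_in_map sd) (pmod_map_comp _ _ (ltW sc.2)).
exact: (colim_canon_in _ (d := SigSub (mem_set sc) : sbelow S c)).
Qed.

End Induced.

(** * Submodules, and what minimality of an epimorphism forces on them *)

Section Submodule.
Variables (R : comPzRingType) (V : lmodType R) (U : submodClosed V).

Record submod := Submod { submod_val : V; _ : submod_val \in U }.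
HB.instance Definition _ := [isSub of submod for submod_val].
HB.instance Definition _ := [Choice of submod by <:].
HB.instance Definition _ := [SubChoice_isSubLmodule of submod by <:].

End Submodule.

Section MinimalEpi.
Variables (R : comPzRingType) (disp : Order.disp_t) (C : porderType disp).

(** The family [U] is a submodule of N on which [f] is still onto, so minimality makes its inclusion
    an epimorphism. *)
Lemma minimal_epi_sub (M N : pmod R C) (f : phom N M) (U : forall c, {pred N c}) :
  minimal_epi f -> (forall c, submod_closed (U c)) ->
  (forall (c d : C) (h : (c <= d)%O) x, x \in U c -> pmod_map N h x \in U d) ->
  (forall c m, exists2 x, x \in U c & f c x = m) ->
  forall c x, x \in U c.
Proof.
move=> [_ fmin] Usub Umap Usurj.
pose U' c : submodClosed (N c) := HB.pack (U c)
  (GRing.isSubmodClosed.Build R (N c) (U c) (GRing.submod_closed_semi (Usub c))).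
pose obj c : lmodType R := submod (U' c).
pose map_fun c d (h : (c <= d)%O) (x : obj c) : obj d :=
  Submod (Umap c d h _ (valP x) : _ \in U' d).
have map_linear c d (h : (c <= d)%O) : linear (map_fun c d h).
  by move=> a x y; apply: val_inj; rewrite /= linearP.
pose map c d (h : (c <= d)%O) : {linear obj c -> obj d} :=
  HB.pack (map_fun c d h) (GRing.isLinear.Build R _ _ _ _ (map_linear c d h)).
have map_id (c : C) (h : (c <= c)%O) x : map c c h x = x.
  by apply: val_inj; exact: pmod_map_id.
have map_comp (c d e : C) (h : (c <= d)%O) (k : (d <= e)%O) (l : (c <= e)%O) x :
    map d e k (map c d h x) = map c e l x.
  by apply: val_inj; exact: pmod_map_comp.
pose incl_fun c : {linear obj c -> N c} := val.
pose incl : phom (PMod map_id map_comp) N :=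
  @PHom _ _ _ (PMod map_id map_comp) N incl_fun (fun _ _ _ _ => erefl).
have /fmin incl_epi : pepi (phom_comp f incl).
  by move=> c m; have [x xU <-] := Usurj c m; exists (Submod (xU : x \in U' c)).
by move=> c x; have [[y yU] <-] := incl_epi c x.
Qed.

Variables (S : set C) (M N : pmod R C) (f : phom N M).

Lemma cover_pepi_counit :
  presented S M -> minimal_epi f -> pepi (counit S N).
Proof. by move=> pM [fs fmin]; apply/fmin/pepi_counit_comp. Qed.

Let top_pi (K : pmod R C) c : {linear K c -> top_module S K c} :=
  quotmod_pi (image_pred (lambda S K c)).

Let top_pi_surj K c : surjective (top_pi K c).
Proof. exact: quotmod_pi_surj. Qed.

Let top_pi_eq0 (K : pmod R C) c x :
  top_pi K c x = 0 <-> exists u, lambda S K c u = x.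
Proof.
rewrite -(linear0 (top_pi K c)); split=> [/quotmod_piP|[u ux]].
  by rewrite subr0 => /asboolP[u _ <-]; exists u.
by apply/quotmod_piP; rewrite subr0; apply/asboolP; exists u.
Qed.

(** This is injectivity of the map [fbar] induced by [f] on tops, stated without quotients.
    Minimality makes a section of [fbar] surjective, so [fbar] is injective. *)
Lemma cover_top_inj c :
  presented S M -> minimal_epi f ->
  (births S M c -> projective_module (top_module S M c)) ->
  forall x u, lambda S M c u = f c x -> exists v, lambda S N c v = x.
Proof.
move=> pM fmin proj; have eps := cover_pepi_counit pM fmin.
have fs : pepi f by case: fmin.
have [fbar fbarE] : exists fbar : {linear top_module S N c -> top_module S M c},
    fbar \o top_pi N c =1 top_pi M c \o f c.
  apply: linear_factor => [|x /top_pi_eq0[u <-]]; first exact: top_pi_surj.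
  by apply/top_pi_eq0; exists (colim_map _ f u); exact: lambda_nat.
have [sec secK] : exists sec : {linear top_module S M c -> top_module S N c},
    fbar \o sec =1 idfun.
  (* Outside the births [lambda] is onto, so the top of M vanishes and the zero map is a section. *)
  have [cB|/contrapT lamS] := pselect (births S M c).
    apply: (proj cB) => t; have [m <-] := top_pi_surj t.
    by have [x <-] := fs c m; exists (top_pi N c x); exact: fbarE.
  exists \0 => t; have [m <-] := top_pi_surj t.
  by rewrite /= linear0; apply/esym/top_pi_eq0; exact: lamS.
(* Quantifying over d <= c describes "the preimage of the image of [sec] in
   degree c, everything elsewhere" without transporting along d = c. *)
pose U d : {pred N d} := fun x =>
  `[< forall h : (d <= c)%O, range sec (top_pi N c (pmod_map N h x)) >].
have UT : forall d x, x \in U d.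
  apply: (minimal_epi_sub (f := f)) => //.
  - move=> d; split; first by apply/asboolP=> h; exists 0; rewrite ?linear0.
    move=> a x y /asboolP xU /asboolP yU; apply/asboolP=> h.
    have [t _ tx] := xU h; have [t' _ ty] := yU h.
    by exists (a *: t + t'); rewrite // !linearP tx ty.
  - move=> d e h x /asboolP xU; apply/asboolP=> k.
    by rewrite (pmod_map_comp _ _ (le_trans h k)); exact: xU.
  (* For d different from c any preimage works: if d < c, its transport to c vanishes in the top. *)
  - move=> d m; have [dc|dc] := eqVneq d c; last first.
      have [x <-] := fs d m; exists x => //; apply/asboolP=> h; exists 0 => //.
      rewrite linear0; apply/esym/top_pi_eq0/pmod_map_lambda => //.
      by rewrite lt_neqAle dc.
    (* In degree c, [n] lifts the class prescribed by [sec], and [f c n - m] is [lambda] of some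
       [u]. Subtracting [lambda] of a lift [v] of [u] corrects the image of [n] without changing its
       class. *)
    subst d; have [n nE] := top_pi_surj (sec (top_pi M c m)).
    have /top_pi_eq0[u uE] : top_pi M c (f c n - m) = 0.
      rewrite linearB -[X in X - _]fbarE /= nE -[X in X - _]/((fbar \o sec) _).
      by rewrite secK subrr.
    have [v vE] := colim_map_surj fs (J := sbelow S c) u.
    exists (n - lambda S N c v); last first.
      by rewrite linearB -lambda_nat vE uE subKr.
    apply/asboolP=> h; exists (top_pi M c m) => //.
    rewrite pmod_map_id linearB nE; apply/esym.
    have -> : top_pi N c (lambda S N c v) = 0 by apply/top_pi_eq0; exists v.
    by rewrite subr0.
move=> x u ux; apply/top_pi_eq0.
have /asboolP/(_ (lexx c)) := UT c x; rewrite pmod_map_id => -[t _ tx].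
suff t0 : t = 0 by rewrite -tx t0 linear0.
rewrite -[LHS]secK /= tx; apply: etrans (fbarE x) _.
by apply/top_pi_eq0; exists u.
Qed.

End MinimalEpi.

(** * Element chase for the snake lemma applied to [lambda] *)

Unset Implicit Arguments.

Theorem theorem3p28 (R : comPzRingType) (disp : Order.disp_t)
  (C : porderType disp) (S : set C) (M : pmod R C)
  (S_artinian : artinian S)
  (M_presented : presented S M)
  (M_proj : forall c, births S M c -> projective_module (top_module S M c))
  (L N : pmod R C) (i : phom L N) (f : phom N M)
  (if_exact : short_exact i f)
  (f_cover : projective_cover f) :
  births S L = deaths S M.
Proof.
have [i_mono ker_f f_epi] := if_exact.
have [f_min N_proj] := f_cover.
have lamN_inj := lambda_inj N_proj (cover_pepi_counit M_presented f_min).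
have fi c x : f c (i c x) = 0.
  by have : range (i c) (i c x) by []; rewrite ker_f.
suff E c : surjective (lambda S L c) <-> injective (lambda S M c).
  by apply/seteqP; split=> c /= H /E.
split=> [lamL|lamM].
- suff ker0 w : lambda S M c w = 0 -> w = 0.
    move=> x y lxy; apply/eqP; rewrite -subr_eq0; apply/eqP/ker0.
    by rewrite linearB lxy subrr.
  (* A lift [u] of [w] has [lambda] image in the kernel of [f], hence coming from L. Injectivity of
     [lambda] for N then gives [u] = [colim_map] of some [z] along [i], which dies in the colimit of
     M. *)
  have [u <-] := colim_map_surj f_epi w; rewrite lambda_nat => fu0.
  have : range (i c) (lambda S N c u) by rewrite ker_f.
  case=> x _; have [z <-] := lamL x; rewrite -lambda_nat => /lamN_inj <-.
  elim/colim_ind: z => [|z z' IHz IHz'|d z]; first by rewrite !linear0.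
    by rewrite !linearD IHz IHz' addr0.
  by rewrite !colim_map_in fi linear0.
- move=> x.
  (* As [i c x] maps to 0 = [lambda] of 0 in M(c), it is [lambda] of some [u]; by [lamM] this [u]
     dies in the colimit of M, so it comes from L. *)
  have [|u lu] := cover_top_inj M_presented f_min (@M_proj c) (x := i c x) (u := 0).
    by rewrite fi linear0.
  have : colim_map (sbelow S c) f u = 0.
    by apply: lamM; rewrite lambda_nat lu fi linear0.
  move=> /(colim_right_exact if_exact)[z zu]; exists z.
  by apply: i_mono; rewrite -lambda_nat zu.
Qed.
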